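(* There exists $C>0$ such that for all $g\ge3$, every graph $G=(V,E)$ on $n$ vertices with girth at least $g$ and maximum degree $\Delta$, every integer $k>2\Delta$, and every partition of $V$ into disjoint blocks $V=B_1\cup B_2\cup\dots\cup B_N$ with $\mathrm{diameter}(B_i)\le g/2-3$ for all $i$, the mixing time of the block dynamics satisfies $T_{\mathrm{mix}}\le C\Delta n\log n$.
   Context: The block dynamics with blocks $B_1,\dots,B_N$ on the set of proper $k$-colorings of $G$: at each step choose a block $B_i$ uniformly at random and replace the coloring on $B_i$ by a uniformly random proper $k$-coloring of $G$ that agrees with the current coloring outside $B_i$. The mixing time is the minimum $T$ such that from any initial proper coloring the distribution after $T$ steps is within total variation distance $1/4$ of the uniform distribution on proper $k$-colorings.
   Formalization: The formal theorem assumes Δ ≥ 1 (the graph has an edge): for Δ = 0 and k ≥ 2 the bound CΔn log n is 0 while the chain needs at least one step, so the statement fails there. *)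

(* Defs.v *)
From HB Require Import structures.
From Stdlib Require Import Rdefinitions. From Stdlib Require Rpower.
From mathcomp Require Import all_boot all_order all_algebra.
From mathcomp Require Import Rstruct.

Set Implicit Arguments.
Unset Strict Implicit.
Unset Printing Implicit Defensive.

Import Order.TTheory GRing.Theory Num.Theory.
Local Open Scope ring_scope.

Definition simple_graph (V : finType) (e : rel V) : Prop :=
  symmetric e /\ irreflexive e.

Definition degree (V : finType) (e : rel V) (v : V) : nat := #|[set w | e v w]|.
Definition max_degree (V : finType) (e : rel V) : nat := (\max_(v : V) degree e v)%N.

Definition girth_at_least (V : finType) (e : rel V) (g : nat) : Prop :=
  forall c : seq V, ucycle e c -> (3 <= size c)%N -> (g <= size c)%N.

Definition dist_le (V : finType) (e : rel V) (u v : V) (d : nat) : Prop :=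
  exists p : seq V, [/\ path e u p, last u p = v & (size p <= d)%N].

(* diameter(B) <= g/2 - 3, i.e. every two vertices of B are at G-distance
   d with d <= g/2 - 3, equivalently 2 d + 6 <= g *)
Definition diam_le_half_girth_minus3 (V : finType) (e : rel V) (B : {set V}) (g : nat) : Prop :=
  forall u v, u \in B -> v \in B ->
    exists d : nat, dist_le e u v d /\ (2 * d + 6 <= g)%N.

Definition coloring (V : finType) (k : nat) := {ffun V -> 'I_k}.

Definition proper (V : finType) (e : rel V) (k : nat) (c : coloring V k) : bool :=
  [forall u, forall v, e u v ==> (c u != c v)].

Definition compatible (V : finType) (e : rel V) (k : nat) (B : {set V})
  (s : coloring V k) : {set coloring V k} :=
  [set t | proper e t && [forall v, (v \notin B) ==> (t v == s v)]].

Definition block_update (V : finType) (e : rel V) (k : nat) (B : {set V})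
  (s t : coloring V k) : R :=
  if t \in compatible e B s then (#|compatible e B s|%:R)^-1 else 0.

Definition block_step (V : finType) (e : rel V) (k : nat) (P : {set {set V}})
  (s t : coloring V k) : R :=
  (#|P|%:R)^-1 * \sum_(B in P) block_update e B s t.

Fixpoint block_dist (V : finType) (e : rel V) (k : nat) (P : {set {set V}})
  (s0 : coloring V k) (t : nat) : coloring V k -> R :=
  match t with
  | 0 => fun x => if x == s0 then 1 else 0
  | t'.+1 => fun x => \sum_(y : coloring V k) block_dist e P s0 t' y * block_step e P y x
  end.

Definition unif_proper (V : finType) (e : rel V) (k : nat) (x : coloring V k) : R :=
  if proper e x then (#|[set c : coloring V k | proper e c]|%:R)^-1 else 0.

Definition tv_dist (T : finType) (mu nu : T -> R) : R :=
  2^-1 * \sum_(x : T) `|mu x - nu x|.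

Definition mixed_at (V : finType) (e : rel V) (k : nat) (P : {set {set V}}) (T : nat) : Prop :=
  forall s0 : coloring V k, proper e s0 ->
    tv_dist (block_dist e P s0 T) (@unif_proper V e k) <= 4^-1.

(* T_mix <= X : the least T with mixed_at T is at most X, i.e. some T <= X
   satisfies mixed_at T *)
Definition mixing_time_le (V : finType) (e : rel V) (k : nat) (P : {set {set V}}) (X : R) : Prop :=
  exists T : nat, mixed_at e k P T /\ T%:R <= X.

(* Main.v *)
(* Dual form of Dobrushin's uniqueness argument. For a function f on colorings,
   let osc_v(f) be the largest change of f when only the color of v changes.
   Since k > 2 Delta, a heat-bath update at a single vertex w annihilates
   osc_w(f) and adds at most osc_w(f) / (Delta + 1) to osc_u(f) for each
   neighbour u of w. A block update Q_B satisfies Q_B Q_w = Q_B for w in B, so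
   single-site updates inside B may be inserted for free until all oscillation
   in B has leaked out of B. Give v the weight 1 + b_v, where b_v is the number
   of neighbours of v outside its own block: if osc_v(f) <= 1 + b_v for all v,
   then every u in B releases at most Delta + 1 altogether, so that
   osc_v(Q_B f) <= 1 + b_v + #(neighbours of v in B) for v outside B, while
   osc_v(Q_B f) = 0 for v in B. Averaging over the N blocks gives
   osc_v <= 1 + b_v - 1/N, a contraction by the factor
   1 - 1/(N (Delta + 1)). *)
Require Import Defs.
From Stdlib Require Import Reals ZArith Lra.

(** * Real estimates for the number of steps *)

Section NumberOfSteps.
Local Open Scope R_scope.

Lemma pow_one_sub_le_exp (y : R) (T : nat) :
  y <= 1 -> (1 - y) ^ T <= exp (- (INR T * y)).
Proof.
intros y1; induction T as [|T IH].
  simpl; replace (- (0 * y)) with 0 by ring; rewrite exp_0; lra.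
rewrite S_INR; replace (- ((INR T + 1) * y)) with (- y + - (INR T * y)) by ring.
rewrite exp_plus; apply Rmult_le_compat; [lra | apply pow_le; lra | | exact IH].
apply (Rle_trans _ (1 + - y)); [lra | apply exp_ineq1_le].
Qed.

(** With [M = N * (D + 1)] and [L = ln (4 n^2)], any [T >= M * L] makes the power at most
    [exp (- L) = 1 / (4 n^2)], while the prefactor [n * (D + 1)] is at most [n^2]. *)
Lemma exists_number_of_steps (N D n : nat) :
  (1 <= N <= n)%nat -> (1 <= D)%nat -> (D < n)%nat ->
  exists T : nat,
    (1 - / INR (N * S D)) ^ T * INR (n * S D) <= / 4 /\
    INR T <= 9 * INR D * INR n * ln (INR n).
Proof.
intros [N1 Nn] D1 Dn.
apply le_INR in N1; apply le_INR in Nn; apply le_INR in D1; apply le_INR in Dn.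
rewrite !mult_INR, S_INR in *; simpl (INR 1) in *; simpl (INR 0) in *.
set (a := INR N) in *; set (d := INR D) in *; set (m := INR n) in *.
set (M := a * (d + 1)); set (L := ln (4 * m * m)).
assert (m2 : 2 <= m) by lra.
assert (M1 : 1 <= M) by (unfold M; nra).
assert (lnm : ln 2 <= ln m).
  destruct m2 as [lt | eq]; [left; apply ln_increasing; lra | right; f_equal; exact eq].
assert (ln2 := ln_lt_2).
assert (LE : L = 2 * ln 2 + 2 * ln m).
  unfold L; replace (4 * m * m) with (2 * 2 * (m * m)) by ring.
  rewrite !ln_mult by nra; ring.
assert (Lpos : 0 < L) by lra.
destruct (archimed (M * L)) as [up_gt up_le].
assert (MLpos : 0 < M * L) by nra.
assert (up0 : (0 <= up (M * L))%Z) by (apply le_IZR; simpl; lra).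
exists (Z.to_nat (up (M * L))).
assert (TE : INR (Z.to_nat (up (M * L))) = IZR (up (M * L))).
  rewrite INR_IZR_INZ, Z2Nat.id by assumption; reflexivity.
set (T := Z.to_nat (up (M * L))) in *; split.
  assert (Minv : / M <= 1) by (rewrite <- Rinv_1; apply Rinv_le_contravar; lra).
  assert (expL : exp (- (INR T * / M)) <= / (4 * m * m)).
    rewrite <- (exp_ln (4 * m * m)) by nra; fold L; rewrite <- exp_Ropp.
    destruct (Rle_lt_or_eq_dec (- (INR T * / M)) (- L)) as [lt | eq].
    - apply Ropp_le_contravar, (Rmult_le_reg_r M); [lra|].
      rewrite Rmult_assoc, Rinv_l by lra; lra.
    - left; apply exp_increasing; exact lt.
    - right; rewrite eq; reflexivity.
  assert (pow_le := Rle_trans _ _ _ (pow_one_sub_le_exp (/ M) T Minv) expL).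
  apply (Rle_trans _ (/ (4 * m * m) * (m * (d + 1)))).
    apply Rmult_le_compat_r; [nra | exact pow_le].
  apply (Rmult_le_reg_l (4 * m * m)); [nra|].
  rewrite <- Rmult_assoc, Rinv_r, Rmult_1_l by nra; nra.
rewrite TE.
assert (dm : 2 <= d * m) by nra.
(* The constant 9: [M <= 2 d m] and [L <= 4 ln m] give 8, and rounding up costs at most 1, which
   [d * m * ln m] absorbs since [d * m >= 2] and [ln m > 1/2]. *)
assert (MLle : M * L <= (2 * d * m) * (4 * ln m)).
  apply Rmult_le_compat; [lra | lra | unfold M; nra | lra].
assert (1 <= d * m * ln m) by nra.
nra.
Qed.

End NumberOfSteps.

From HB Require Import structures.
From Stdlib Require Import Rdefinitions. From Stdlib Require Rpower.
From mathcomp Require Import all_boot all_order all_algebra.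
From mathcomp Require Import Rstruct.
From mathcomp Require Import ring.
Import Order.TTheory GRing.Theory Num.Theory.

Set Implicit Arguments.
Unset Strict Implicit.
Unset Printing Implicit Defensive.

Local Open Scope ring_scope.

(** * Averages over finite sets *)

Section Mean.
Variables (F : realFieldType) (T : finType).
Implicit Types (A B : {set T}) (f g : T -> F) (c : F).

Definition mean A f : F := (#|A|%:R)^-1 * \sum_(x in A) f x.

Lemma eq_mean A f g : {in A, f =1 g} -> mean A f = mean A g.
Proof. by move=> fg; rewrite /mean (eq_bigr g). Qed.

Lemma mean_le A f c : A != set0 -> {in A, forall x, f x <= c} -> mean A f <= c.
Proof.
rewrite -card_gt0 => A0 fc.
rewrite /mean ler_pdivrMl ?ltr0n // -mulr_natl mulr1 mulr_natl -sumr_const.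
exact: ler_sum.
Qed.

Lemma meanN A f : mean A (fun x => - f x) = - mean A f.
Proof. by rewrite /mean sumrN mulrN. Qed.

Lemma mean_ge A f c : A != set0 -> {in A, forall x, c <= f x} -> c <= mean A f.
Proof.
by move=> A0 fc; rewrite -lerN2 -meanN mean_le // => x xA; rewrite lerN2 fc.
Qed.

Lemma mean_subr_le A B f g c : A != set0 -> B != set0 ->
  {in A & B, forall x y, f x - g y <= c} -> mean A f - mean B g <= c.
Proof.
move=> A0 B0 fg; rewrite lerBlDr -lerBlDl; apply: mean_ge => // y yB.
by rewrite lerBlDl -lerBlDr lerBlDr mean_le // => x xA; rewrite -lerBlDr fg.
Qed.

Lemma mean_pointwise A f g c : A != set0 ->
  {in A, forall x, f x - g x <= c} -> mean A f - mean A g <= c.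
Proof.
move=> A0 fg; rewrite /mean -mulrBr -sumrB; exact: (@mean_le A (fun x => f x - g x)).
Qed.

Lemma sumr_sub_mean A f : A != set0 -> \sum_(x in A) (f x - mean A f) = 0.
Proof.
rewrite -card_gt0 => A0; rewrite sumrB sumr_const -[_ *+ _]mulr_natl /mean mulrA.
by rewrite divff ?mul1r ?subrr // pnatr_eq0 -lt0n.
Qed.

(** Centre [f] at its mean [d] over [B]. The sum over [B] then vanishes, so the sum over [A] is the
    sum over [A :\: B] minus the sum over [B :\: A]. As [A] is the larger set, this remainder is 0,
    [f a - d] or [f a - f b], hence at most [c]. *)
Lemma mean_near_card_le A B f c (q : nat) : (0 < q)%N -> (q <= #|B|)%N ->
  (#|B| <= #|A|)%N -> (#|A :\: B| <= 1)%N ->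
  (forall x y, f x - f y <= c) -> 0 <= c -> mean A f - mean B f <= c / q%:R.
Proof.
move=> q0 qB BA AB fc c0.
have B0 : B != set0 by rewrite -card_gt0 (leq_trans q0).
have A0 : A != set0 by rewrite -card_gt0 (leq_trans q0) // (leq_trans qB).
have qA : (q <= #|A|)%N by apply: leq_trans BA.
set d := mean B f.
have -> : mean A f - d = #|A|%:R^-1 * \sum_(x in A) (f x - d).
  rewrite sumrB sumr_const mulrBr -[d *+ _]mulr_natl mulrA mulVf ?mul1r //.
  by rewrite pnatr_eq0 -lt0n card_gt0.
have sumE : \sum_(x in A) (f x - d)
    = \sum_(x in A :\: B) (f x - d) - \sum_(x in B :\: A) (f x - d).
  have := sumr_sub_mean f B0; rewrite -/d (big_setID A) /=.
  rewrite (big_setID (A := A) B) /= setIC => /eqP.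
  by rewrite addr_eq0 => /eqP ->; rewrite addrC.
have BA1 : (#|B :\: A| <= #|A :\: B|)%N.
  have := BA; rewrite -(cardsID A B) -(cardsID B A) setIC.
  by rewrite leq_add2l.
suff le_c : \sum_(x in A) (f x - d) <= c.
  rewrite mulrC; apply: (@le_trans _ _ (c / #|A|%:R)).
    by rewrite ler_wpM2r // invr_ge0 ler0n.
  by rewrite ler_wpM2l // lef_pV2 ?posrE ?ltr0n ?card_gt0 ?ler_nat.
have fd x : f x - d <= c.
  by rewrite lerBlDr -lerBlDl; apply: mean_ge => // y _; rewrite lerBlDl -lerBlDr fc.
rewrite sumE; move: AB BA1; rewrite leq_eqVlt ltnS leqn0 cards_eq0.
case/orP => [/cards1P [a ->]|/eqP ->]; last first.
  by rewrite cards0 leqn0 cards_eq0 => /eqP ->; rewrite !big_set0 subr0.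
rewrite cards1 leq_eqVlt ltnS leqn0 cards_eq0.
case/orP => [/cards1P [b ->]|/eqP ->]; rewrite ?big_set0 ?subr0 !big_set1 //.
by rewrite opprB addrA subrK.
Qed.

Lemma mean_near A B f c (q : nat) : (0 < q)%N -> (q <= #|A|)%N -> (q <= #|B|)%N ->
  (#|A :\: B| <= 1)%N -> (#|B :\: A| <= 1)%N ->
  (forall x y, f x - f y <= c) -> 0 <= c -> mean A f - mean B f <= c / q%:R.
Proof.
move=> q0 qA qB AB BA fc c0; case: (leqP #|B| #|A|) => [BA'|/ltnW AB'].
  exact: mean_near_card_le.
have := @mean_near_card_le B A (fun x => - f x) c q q0 qA AB' BA.
by rewrite !meanN opprK addrC; apply => // x y; rewrite opprK addrC fc.
Qed.

End Mean.

(** * Block updates of arbitrary colorings *)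

Section HeatBath.
Variables (F : archiRealFieldType) (V : finType) (e : rel V) (k : nat).
Hypotheses (e_sym : symmetric e) (e_irr : irreflexive e).
Local Notation col := (coloring V k).
Implicit Types (s t : col) (A B : {set V}) (f g : col -> F) (a : V -> F) (u v w : V).

Definition agree_off B s t := [forall v, (v \notin B) ==> (t v == s v)].

Lemma agree_offP B s t :
  reflect (forall v, v \notin B -> t v = s v) (agree_off B s t).
Proof.
apply: (iffP forallP) => [h v vB|h v]; first by have /implyP/(_ vB)/eqP := h v.
by apply/implyP => vB; apply/eqP/h.
Qed.

Lemma agree_off_sym B : symmetric (agree_off B).
Proof. by move=> s t; apply/agree_offP/agree_offP => h v vB; rewrite h. Qed.

Definition no_conflict B t :=
  [forall u, forall v, ((u \in B) && e u v) ==> (t u != t v)].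

Lemma no_conflictP B t :
  reflect (forall u v, u \in B -> e u v -> t u != t v) (no_conflict B t).
Proof.
apply: (iffP 'forall_forallP) => [h u v uB uv|h u v].
  by have /implyP := h u v; rewrite uB uv => /(_ isT).
by apply/implyP => /andP [uB uv]; apply: h.
Qed.

(* Unlike [compatible], conflicts outside [B] are tolerated: the update is then
   defined from every coloring, and any two colorings can be joined by changing
   one vertex at a time. *)
Definition recolorings B s := [set t | agree_off B s t && no_conflict B t].

Definition heat_bath B f s : F := mean (recolorings B s) f.

Lemma recolorings_agree B s t : agree_off B s t -> recolorings B s = recolorings B t.
Proof.
move/agree_offP => st; apply/setP => x; rewrite !inE; congr (_ && _).
by apply/agree_offP/agree_offP => h v vB; rewrite h // st.
Qed.

Lemma recolorings_compatible B s : Defs.proper e s -> recolorings B s = compatible e B s.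
Proof.
move=> /'forall_forallP s_pr; apply/setP => t; rewrite !inE -/(agree_off B s t) andbC.
case: agree_offP => st; rewrite ?andbF // !andbT.
apply/no_conflictP/'forall_forallP => h u v; last first.
  by move=> _; apply/implyP.
apply/implyP => uv; have [uB|uB] := boolP (u \in B); first exact: h.
have [vB|vB] := boolP (v \in B); first by rewrite eq_sym h // e_sym.
by rewrite !st //; have /implyP/(_ uv) := s_pr u v.
Qed.

Lemma recolorings_setT s : recolorings [set: V] s = [set c | Defs.proper e c].
Proof.
apply/setP => t; rewrite !inE.
have -> : agree_off [set: V] s t by apply/agree_offP => v; rewrite inE.
by apply/no_conflictP/'forall_forallP => h u v;
  [apply/implyP/h|move=> _; apply/implyP/h].
Qed.

(** An edge that meets [B] but not [A] keeps its colors from [t], where it is free of conflicts;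
    this is the consistency behind the tower property. *)
Lemma recolorings_sub A B s t t' : A \subset B -> t \in recolorings B s ->
  (t' \in recolorings A t) = (t' \in recolorings B s) && agree_off A t t'.
Proof.
move=> /subsetP AB; rewrite !inE => /andP [/agree_offP st /no_conflictP tB].
case: (agree_offP A t t') => tt'; rewrite ?andbF // andbT /=.
have -> /= : agree_off B s t'.
  by apply/agree_offP => v vB; rewrite tt' ?st //; apply: contra vB; apply: AB.
apply/no_conflictP/no_conflictP => h u v uB uv; last by apply: h => //; apply: AB.
have [uA|uA] := boolP (u \in A); first exact: h.
have [vA|vA] := boolP (v \in A); first by rewrite eq_sym h // e_sym.
by rewrite !tt' // tB.
Qed.

(** Agreement off [A] splits the recolorings of [B] into classes, and the update of [A] is uniform
    on the class of its argument. Each [t'] thus collects the inverse class size once per member of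
    its class, in total 1. *)
Lemma heat_bath_tower A B f s :
  A \subset B -> heat_bath B (heat_bath A f) s = heat_bath B f s.
Proof.
move=> AB; rewrite /heat_bath /mean; congr (_ * _).
transitivity (\sum_(t in recolorings B s)
    \sum_(t' in recolorings B s | agree_off A t t')
      (#|recolorings A t|%:R)^-1 * f t').
  apply: eq_bigr => t tB; rewrite big_distrr /=.
  by apply: eq_bigl => t'; rewrite (recolorings_sub _ AB tB).
rewrite (exchange_big_dep (mem (recolorings B s))) /=; last by move=> i j _ /andP[].
apply: eq_bigr => t' t'B; rewrite -big_distrl /=.
transitivity ((\sum_(t in recolorings A t') (#|recolorings A t'|%:R)^-1) * f t').
  congr (_ * _); apply: eq_big => [t|t /and3P [_ _ tt']].
    by rewrite (recolorings_sub _ AB t'B) t'B agree_off_sym.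
  by rewrite (recolorings_agree tt').
rewrite sumr_const -[_ *+ #|_|]mulr_natl divff ?mul1r // pnatr_eq0 -lt0n card_gt0.
apply/set0Pn; exists t'; rewrite (recolorings_sub _ AB t'B) t'B.
by apply/agree_offP.
Qed.

Definition paint w (c : 'I_k) s : col := [ffun v => if v == w then c else s v].

Definition free_colors w s : {set 'I_k} := ~: (s @: [set v | e w v]).

Lemma free_colorsP w s c :
  reflect (forall v, e w v -> c != s v) (c \in free_colors w s).
Proof.
rewrite !inE; apply: (iffP idP) => [h v wv|h].
  by apply: contra h => /eqP ->; rewrite imset_f ?inE.
by apply/imsetP => -[v]; rewrite inE => /h /eqP.
Qed.

Lemma card_free_colors w s : (k - max_degree e <= #|free_colors w s|)%N.
Proof.
rewrite /free_colors cardsCs setCK card_ord; apply: leq_sub2l.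
apply: (leq_trans (leq_imset_card _ _)).
exact: (@leq_bigmax _ (degree e) w).
Qed.

Lemma paint_inj w s : injective (paint w ^~ s).
Proof. by move=> c c' /ffunP /(_ w); rewrite !ffunE eqxx. Qed.

Lemma paint_agree w c s : agree_off [set w] s (paint w c s).
Proof. by apply/agree_offP => v; rewrite inE ffunE => /negPf ->. Qed.

Lemma recolorings_set1 w s :
  recolorings [set w] s = paint w ^~ s @: free_colors w s.
Proof.
have neq v : e w v -> v == w = false.
  by move=> wv; apply/eqP => vw; rewrite vw e_irr in wv.
apply/setP => t; rewrite inE; apply/andP/imsetP.
  case=> /agree_offP st /no_conflictP tw; exists (t w).
    apply/free_colorsP => v wv; rewrite -st ?inE ?neq //.
    by rewrite tw // inE.
  apply/ffunP => v; rewrite ffunE; case: (v =P w) => [-> //|/eqP vw].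
  by rewrite st // inE.
case=> c /free_colorsP cw ->; split; first exact: paint_agree.
apply/no_conflictP => u v; rewrite inE => /eqP -> wv.
by rewrite !ffunE eqxx neq ?cw.
Qed.

Lemma heat_bath_set1 w f s :
  heat_bath [set w] f s = mean (free_colors w s) (fun c => f (paint w c s)).
Proof.
rewrite /heat_bath /mean recolorings_set1 card_imset; last exact: paint_inj.
by rewrite big_imset //= => c c' _ _; apply: paint_inj.
Qed.

(** * Oscillation of functions on colorings *)

Definition osc_le f a := forall v s t, agree_off [set v] s t -> f s - f t <= a v.

(** The vertices of [l] are repainted one at a time. The intermediate colorings may be improper,
    which is why [osc_le] ranges over all colorings. *)
Lemma osc_le_seq f a (l : seq V) s t : osc_le f a ->
  (forall v, v \notin l -> t v = s v) -> f s - f t <= \sum_(v <- l) a v.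
Proof.
move=> fa; elim: l s => [|w l IH] s st.
  by rewrite big_nil (_ : t = s) ?subrr //; apply/ffunP => v; apply: st.
rewrite big_cons -(subrK (f (paint w (t w) s)) (f s)) -addrA lerD //.
  by apply: fa; apply: paint_agree.
apply: IH => v vl; rewrite ffunE; case: eqP => [-> //|/eqP vw].
by rewrite st // inE negb_or vw.
Qed.

Lemma osc_le_set f a B s t : osc_le f a -> agree_off B s t ->
  f s - f t <= \sum_(v in B) a v.
Proof.
move=> fa /agree_offP st; rewrite -big_enum; apply: osc_le_seq => // v.
by rewrite mem_enum => /st.
Qed.

(** * Effect of updates on oscillations when [k > 2 * D] *)

Section ManyColors.
Hypothesis k_gt : (2 * max_degree e < k)%N.
Local Notation D := (max_degree e).

(** Here [k > 2 * D] enters; the bound [D + 1] becomes the denominator of the influence of one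
    vertex on another. *)
Lemma card_free_colors_gt w s : (D.+1 <= #|free_colors w s|)%N.
Proof.
apply: leq_trans (card_free_colors w s).
by rewrite ltn_subRL addnn -mul2n.
Qed.

Lemma free_colors_neq0 w s : free_colors w s != set0.
Proof. by rewrite -card_gt0 (leq_trans _ (card_free_colors_gt w s)). Qed.

(** Greedy coloring: once [B :\ w] is recolored, some color is still free at [w]. *)
Lemma recolorings_neq0 B s : recolorings B s != set0.
Proof.
move: {2}#|B| (leqnn #|B|) => n; elim: n B => [|n IH] B.
  rewrite leqn0 cards_eq0 => /eqP ->; apply/set0Pn; exists s.
  by rewrite inE; apply/andP; split; [apply/agree_offP|apply/no_conflictP => u v; rewrite inE].
move=> Bn; have [->|/set0Pn [w wB]] := eqVneq B set0; first by apply: IH; rewrite cards0.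
have /set0Pn [t] : recolorings (B :\ w) s != set0.
  by apply: IH; move: Bn; rewrite (cardsD1 w) wB.
rewrite inE => /andP [/agree_offP st /no_conflictP tB].
have /set0Pn [c /free_colorsP cw] := free_colors_neq0 w t.
apply/set0Pn; exists (paint w c t); rewrite inE; apply/andP; split.
  apply/agree_offP => v vB; rewrite ffunE.
  by case: eqP vB => [->|/eqP vw vB]; rewrite ?wB // st // !inE vw.
apply/no_conflictP => u v uB uv; rewrite !ffunE.
case: (u =P w) => [uw|/eqP uw].
  case: (v =P w) => [vw|_]; first by rewrite uw vw e_irr in uv.
  by apply: cw; rewrite -uw.
case: (v =P w) => [vw|_]; first by rewrite eq_sym cw // -vw e_sym.
by apply: tB => //; rewrite !inE uw.
Qed.

Lemma heat_bath_osc1 w f a : osc_le f a ->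
  osc_le (heat_bath [set w] f)
    (fun u => if u == w then 0 else a u + (e u w)%:R * (a w / D.+1%:R)).
Proof.
move=> fa u s t; case: (u =P w) => [-> st|/eqP uw /agree_offP st].
  by rewrite /heat_bath (recolorings_agree st) subrr.
have st' v : v != u -> t v = s v by move=> vu; rewrite st // inE.
rewrite !heat_bath_set1.
set As := free_colors w s; set At := free_colors w t.
(* Split the change in two: first [s] becomes [t] with the law of the new color at [w] kept, which
   costs [a u]; then the law changes from uniform on [As] to uniform on [At]. *)
rewrite -(subrK (mean As (fun c => f (paint w c t))) (mean As _)) -addrA.
apply: lerD.
  apply: mean_pointwise; first exact: free_colors_neq0.
  move=> c _; apply: fa; apply/agree_offP => v; rewrite inE !ffunE => vu.
  by case: eqP => // _; rewrite st'.
have aw0 : 0 <= a w by rewrite -(subrr (f s)); apply: fa; apply/agree_offP.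
have [uw_e|uw_e] := boolP (e u w); last first.
  rewrite mul0r (_ : As = At) ?subrr //; apply/setP => c.
  have st_nbr v : e w v -> t v = s v.
    by move=> wv; apply: st'; apply: contra uw_e => /eqP <-; rewrite e_sym.
  by apply/free_colorsP/free_colorsP => h v wv; move: (h v wv); rewrite st_nbr.
(* A color free for [x] but not for [y] must be [y u], so each list of free colors has at most one
   color missing from the other. *)
have sub1 (x y : col) c c' : (forall v, v != u -> x v = y v) ->
    c \in free_colors w x :\: free_colors w y ->
    c' \in free_colors w x :\: free_colors w y -> c = c'.
  move=> xy; suff h b : b \in free_colors w x :\: free_colors w y -> b = y u.
    by move=> /h -> /h ->.
  rewrite inE => /andP [/free_colorsP nb /free_colorsP b_x].
  apply/eqP/negPn/negP => byu; apply: nb => v wv.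
  by case: (v =P u) => [->//|/eqP vu]; rewrite -xy // b_x.
rewrite mul1r; apply: mean_near => //; try exact: card_free_colors_gt.
- by apply/card_le1_eqP => c c' hc hc'; apply: sub1 hc' hc => v vu; rewrite st'.
- by apply/card_le1_eqP => c c' hc hc'; apply: sub1 hc' hc => v vu; rewrite st'.
- move=> c c'; apply: fa; apply/agree_offP => v; rewrite inE !ffunE.
  by move/negPf ->.
Qed.

Definition nbrs_in B v : nat := #|[set u in B | e v u]|.

Lemma sum_nbrs_in B v (p : V -> F) c : (forall u, p u <= c) ->
  \sum_(u in B | e v u) p u <= (nbrs_in B v)%:R * c.
Proof.
move=> pc; rewrite mulr_natl /nbrs_in -sumr_const.
by under [leRHS]eq_bigl do rewrite inE; apply: ler_sum.
Qed.

(* [p u] is the total oscillation released at [u] by the single-site updates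
   performed so far. Each further update releases at least [eps], whereas [p]
   stays bounded. *)
Lemma heat_bath_relax_steps B f a c eps n : 0 <= c -> osc_le f a ->
  {in B, forall u, a u <= c * (D.+1%:R - (nbrs_in B u)%:R)} ->
  exists h b p,
    [/\ osc_le h b,
        heat_bath B h =1 heat_bath B f,
        forall u, p u + b u <= a u + (\sum_(w in B | e u w) p w) / D.+1%:R,
        (forall u, p u <= c * D.+1%:R) /\ {in ~: B, forall u, p u = 0} &
        {in B, forall u, b u < eps} \/ n%:R * eps <= \sum_(u in B) p u].
Proof.
move=> c0 fa aB; have D0 : 0 < D.+1%:R :> F by rewrite ltr0n.
elim: n => [|n [h [b [p [hb hf pb [pc pB] ends]]]]].
  exists f, a, (fun=> 0); split=> //.
  - by move=> u; rewrite big1 // mul0r addr0 add0r.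
  - by split=> // u; rewrite mulr_ge0 // ltW.
  - by right; rewrite mul0r big1.
have [/forallP small|/forallPn [w]] := boolP [forall u in B, b u < eps].
  by exists h, b, p; split=> //; left=> u uB; apply/(implyP (small u)).
rewrite negb_imply -leNgt => /andP [wB bw].
have large : n%:R * eps <= \sum_(u in B) p u.
  by case: ends => // /(_ _ wB); rewrite ltNge bw.
pose p' u := p u + (u == w)%:R * b w.
have sum_p' (Q : pred V) :
    \sum_(x in B | Q x) p' x = \sum_(x in B | Q x) p x + (Q w)%:R * b w.
  rewrite big_split /=; congr (_ + _); rewrite -big_distrl /=; congr (_ * _).
  rewrite big_mkcond (bigD1 w) //= wB eqxx big1 ?addr0; first by case: (Q w).
  by move=> x /negPf ->; rewrite if_same.
exists (heat_bath [set w] h),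
  (fun u => if u == w then 0 else b u + (e u w)%:R * (b w / D.+1%:R)), p'.
split.
- exact: heat_bath_osc1.
- by move=> s; rewrite heat_bath_tower ?sub1set.
- move=> u; rewrite sum_p' /p'; have := pb u.
  case: (u =P w) => [->|_]; rewrite ?e_irr ?mul0r ?mul1r ?addr0 //.
  by rewrite mulrDl !addrA -(mulrA (e u w)%:R) lerD2r.
- split=> u; last first.
    rewrite inE => uB; rewrite /p' pB ?inE // (_ : u == w = false) ?mul0r ?addr0 //.
    by apply: contraNF uB => /eqP ->.
  rewrite /p'; case: (u =P w) => [->|_]; rewrite ?mul0r ?mul1r ?addr0 //.
  (* The bound [c * (D + 1)] reproduces itself: [w] starts with at most [c * (D + 1 - nbrs_in B w)]
     and receives at most [c] from each neighbour in [B]. *)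
  apply: (le_trans (pb w)); have := sum_nbrs_in B w pc.
  rewrite mulrA -ler_pdivrMr // => le_n.
  have := lerD (aB w wB) le_n.
  by rewrite mulrBr [c * (nbrs_in B w)%:R]mulrC subrK.
- right; have -> : \sum_(x in B) p' x = \sum_(x in B) p x + b w.
    have := sum_p' xpredT; rewrite mul1r => sum_p'T.
    transitivity (\sum_(x in B | xpredT x) p' x); first by apply: eq_bigl => x; rewrite andbT.
    by rewrite sum_p'T; congr (_ + _); apply: eq_bigl => x; rewrite andbT.
  by rewrite -addn1 natrD mulrDl mul1r lerD.
Qed.

Lemma heat_bath_relax B f a c eps : 0 <= c -> 0 < eps -> osc_le f a ->
  {in B, forall u, a u <= c * (D.+1%:R - (nbrs_in B u)%:R)} ->
  exists h b,
    [/\ osc_le h b,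
        heat_bath B h =1 heat_bath B f,
        {in B, forall u, b u < eps} &
        {in ~: B, forall v, b v <= a v + c * (nbrs_in B v)%:R}].
Proof.
move=> c0 e0 fa aB; have D0 : 0 < D.+1%:R :> F by rewrite ltr0n.
(* Chosen so that [n * eps] exceeds [#|B| * c * (D + 1)], the most that [B] can release in total;
   only the alternative of small oscillations survives. *)
pose n := Num.bound (#|B|%:R * (c * D.+1%:R) / eps).
have := heat_bath_relax_steps eps n c0 fa aB.
move=> [h [b [p [hb hf pb [pc pB] ends]]]].
exists h, b; split=> //.
  case: ends => // /le_trans /(_ (ler_sum _ (fun u _ => pc u))).
  rewrite sumr_const -[_ *+ #|_|]mulr_natl leNgt -ltr_pdivrMr // archi_boundP //.
  by rewrite !mulr_ge0 ?invr_ge0 // ltW.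
move=> v vB; have := pb v; rewrite pB // add0r => /le_trans; apply.
rewrite lerD2l ler_pdivrMr // (le_trans (sum_nbrs_in _ _ pc)) //.
by rewrite mulrA [_ * c]mulrC.
Qed.

(** Replace [f] by a relaxed [h] with the same block average. Any two outcomes of the update differ
    only on [v |: B], where [B] contributes at most [eps] in total and [v] the claimed bound; then
    [eps] tends to 0. *)
Lemma heat_bath_osc B f a c : 0 <= c -> osc_le f a ->
  {in B, forall u, a u <= c * (D.+1%:R - (nbrs_in B u)%:R)} ->
  osc_le (heat_bath B f)
    (fun v => if v \in B then 0 else a v + c * (nbrs_in B v)%:R).
Proof.
move=> c0 fa aB v s t st; case: ifPn => vB.
  rewrite /heat_bath (@recolorings_agree _ s t) ?subrr //.
  apply/agree_offP => x xB; move/agree_offP: st; apply; rewrite inE.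
  by apply: contra xB => /eqP ->.
apply/ler_addgt0Pr => eps e0.
have e'0 : 0 < eps / #|B|.+1%:R by rewrite divr_gt0 ?ltr0n.
have [h [b [hb hf bB bv]]] := heat_bath_relax c0 e'0 fa aB.
rewrite -!hf; apply: mean_subr_le; try exact: recolorings_neq0.
move=> x y; rewrite !inE => /andP [/agree_offP sx _] /andP [/agree_offP ty _].
have xy : agree_off (v |: B) x y.
  apply/agree_offP => u; rewrite !inE negb_or => /andP [uv uB].
  by rewrite sx // ty //; move/agree_offP: st => ->; rewrite ?inE.
apply: (le_trans (osc_le_set hb xy)).
rewrite big_setU1 //= lerD ?bv ?inE //.
apply: (@le_trans _ _ (\sum_(u in B) eps / #|B|.+1%:R)).
  by apply: ler_sum => u /bB /ltW.
rewrite sumr_const -[_ *+ #|_|]mulr_natl mulrCA ler_piMr ?ltW //.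
by rewrite ltr_pdivrMr ?ltr0n // mul1r ltr_nat.
Qed.

(** * Averaging over the blocks of a partition *)

Section Blocks.
Variable P : {set {set V}}.
Hypothesis P_part : partition P [set: V].

Definition block_mean f s : F := mean P (fun B => heat_bath B f s).

Definition boundary_weight v : F :=
  (#|[set u | e v u & u \notin pblock P v]|).+1%:R.

Let trivP : trivIset P. Proof. by case/and3P: P_part. Qed.
Let pblock_in v : pblock P v \in P.
Proof. by rewrite pblock_mem // (cover_partition P_part) inE. Qed.
Let pblock_self v : v \in pblock P v.
Proof. by rewrite mem_pblock (cover_partition P_part) inE. Qed.

Lemma degree_pblock v :
  (nbrs_in (pblock P v) v + #|[set u | e v u & u \notin pblock P v]|)%N = degree e v.
Proof.
rewrite /degree /nbrs_in -(cardsID (pblock P v) [set w | e v w]).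
by congr (_ + _)%N; apply: eq_card => u; rewrite !inE // andbC.
Qed.

Lemma boundary_weight_ge1 v : 1 <= boundary_weight v.
Proof. by rewrite /boundary_weight ler1n. Qed.

(** Neighbours inside and outside the block add up to the degree. This makes the weights admissible
    in [heat_bath_osc]. *)
Lemma boundary_weight_le_nbrs B u : B \in P -> u \in B ->
  boundary_weight u <= D.+1%:R - (nbrs_in B u)%:R.
Proof.
move=> BP uB; rewrite lerBrDr -natrD ler_nat addSn ltnS addnC.
rewrite -(def_pblock trivP BP uB) degree_pblock.
exact: (@leq_bigmax _ (degree e) u).
Qed.

Lemma boundary_weight_le v : boundary_weight v <= D.+1%:R.
Proof.
apply: (le_trans (boundary_weight_le_nbrs (pblock_in v) (pblock_self v))).
by rewrite gerBl ler0n.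
Qed.

Lemma sum_nbrs_other_blocks v :
  \sum_(B in P | B != pblock P v) (nbrs_in B v)%:R = boundary_weight v - 1.
Proof.
have sumP : (\sum_(B in P) nbrs_in B v)%N = degree e v.
  rewrite /degree -sum1_card.
  under [RHS]eq_bigl do rewrite inE.
  transitivity (\sum_(u in [set: V] | e v u) 1)%N; last first.
    by apply: eq_bigl => u; rewrite inE.
  rewrite (set_partition_big_cond P) //; apply: eq_bigr => B _.
  by rewrite /nbrs_in -sum1_card; apply: eq_bigl => u; rewrite inE.
rewrite -natr_sum /boundary_weight -[(_.+1)%:R]natr1 addrK.
congr (_ *+ _); apply: (@addnI (nbrs_in (pblock P v) v)).
by rewrite degree_pblock -sumP [RHS](bigD1 (pblock P v)).
Qed.

Lemma block_mean_contract f c : 0 <= c ->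
  osc_le f (fun v => c * boundary_weight v) ->
  osc_le (block_mean f)
    (fun v => c * (1 - (#|P| * D.+1)%:R^-1) * boundary_weight v).
Proof.
move=> c0 fc v s t st.
have P0 : 0 < #|P|%:R :> F.
  by rewrite ltr0n card_gt0; apply/set0Pn; exists (pblock P v).
have D0 : 0 < D.+1%:R :> F by rewrite ltr0n.
set W := boundary_weight v.
rewrite /block_mean /mean -mulrBr -sumrB.
have le_sum : \sum_(B in P) (heat_bath B f s - heat_bath B f t)
    <= c * (#|P|%:R * W - 1).
  have osc B : B \in P -> heat_bath B f s - heat_bath B f t
      <= if v \in B then 0 else c * W + c * (nbrs_in B v)%:R.
    move=> BP; apply: (heat_bath_osc c0 fc _ st) => u uB.
    by rewrite ler_wpM2l // boundary_weight_le_nbrs.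
  apply: (le_trans (ler_sum _ osc)).
  (* With [N] blocks, the block of [v] contributes 0, the others [c * W] each, and their neighbours
     of [v] add [c * (W - 1)]: in all [c * (N * W - 1)]. *)
  rewrite (bigD1 (pblock P v)) //= pblock_self add0r.
  rewrite (eq_bigr (fun B => c * W + c * (nbrs_in B v)%:R)); last first.
    move=> B /andP [BP Bv]; case: ifP => // vB.
    by rewrite (def_pblock trivP BP vB) eqxx in Bv.
  rewrite big_split /= -[X in _ + X]mulr_sumr sum_nbrs_other_blocks -/W.
  have : \sum_(B in P) c * W = #|P|%:R * (c * W).
    by rewrite sumr_const -[_ *+ #|_|]mulr_natl.
  rewrite (bigD1 (pblock P v)) //= => /(canRL (addKr _)) ->.
  by rewrite le_eqVlt; apply/orP; left; apply/eqP; ring.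
rewrite mulrC ler_pdivrMr //; apply: (le_trans le_sum).
rewrite -!mulrA ler_wpM2l //.
have -> : (1 - (#|P| * D.+1)%:R^-1) * (W * #|P|%:R)
    = #|P|%:R * W - W / D.+1%:R.
  rewrite natrM; move: D0 P0; move: (D.+1%:R : F) (#|P|%:R : F) => d N d0 N0.
  by field; rewrite !gt_eqF.
(* The additive gain 1 becomes multiplicative through [W <= D + 1]. *)
by rewrite lerD2l lerN2 ler_pdivrMr // mul1r boundary_weight_le.
Qed.

Lemma contraction_rate_ge0 : V -> 0 <= 1 - (#|P| * D.+1)%:R^-1 :> F.
Proof.
move=> v; suff PD : (0 < #|P| * D.+1)%N by rewrite subr_ge0 invf_le1 ?ltr0n ?ler1n.
by rewrite muln_gt0 andbT card_gt0; apply/set0Pn; exists (pblock P v).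
Qed.

Lemma iter_block_mean_osc T f c : 0 <= c -> (forall s t, f s - f t <= c) ->
  osc_le (iter T block_mean f)
    (fun v => c * (1 - (#|P| * D.+1)%:R^-1) ^+ T * boundary_weight v).
Proof.
move=> c0 fc; elim: T => [|T IH].
  move=> v s t _; rewrite expr0 mulr1; apply: (le_trans (fc s t)).
  by rewrite ler_peMr // boundary_weight_ge1.
move=> v s t st; rewrite exprSr mulrA; apply: (block_mean_contract _ IH st).
by rewrite mulr_ge0 // exprn_ge0 // contraction_rate_ge0.
Qed.

Lemma iter_block_mean_le T f c s t : 0 <= c -> (forall s t, f s - f t <= c) ->
  iter T block_mean f s - iter T block_mean f t
    <= c * (1 - (#|P| * D.+1)%:R^-1) ^+ T * (#|V| * D.+1)%:R.
Proof.
move=> c0 fc.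
have st : agree_off [set: V] s t by apply/agree_offP => v; rewrite inE.
apply: (le_trans (osc_le_set (iter_block_mean_osc T c0 fc) st)).
rewrite -big_distrr /=.
have [V0|V0] := posnP #|V|.
  rewrite big1 ?mulr0 ?V0 ?mul0n ?mulr0 // => v.
  by have := card0_eq V0 v; rewrite inE.
have /card_gt0P [v0 _] := V0.
rewrite ler_wpM2l ?mulr_ge0 ?exprn_ge0 ?contraction_rate_ge0 //.
rewrite natrM mulr_natl -cardsT -sumr_const; apply: ler_sum => v _.
exact: boundary_weight_le.
Qed.

(** Stationarity: the uniform law on proper colorings is the heat bath on the whole vertex set, and
    the tower property absorbs the update of any block into it. *)
Lemma mean_proper_block_mean f : V ->
  mean [set s | Defs.proper e s] (block_mean f) = mean [set s | Defs.proper e s] f.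
Proof.
move=> v; have P0 : #|P|%:R != 0 :> F.
  by rewrite pnatr_eq0 -lt0n card_gt0; apply/set0Pn; exists (pblock P v).
set pr := [set s | _].
have [pr0|/set0Pn [s _]] := eqVneq pr set0; first by rewrite /mean pr0 !big_set0.
have heat_bathP B : mean pr (heat_bath B f) = mean pr f.
  by rewrite /pr -(recolorings_setT s) -!/(heat_bath _ _ _) heat_bath_tower.
rewrite /block_mean {1}/mean -mulr_sumr exchange_big mulrCA mulr_sumr /=.
under eq_bigr do rewrite -/(mean pr (heat_bath _ f)) heat_bathP.
by rewrite sumr_const -[_ *+ #|_|]mulr_natl mulrA mulVf ?mul1r.
Qed.

Lemma mean_proper_iter T f : V ->
  mean [set s | Defs.proper e s] (iter T block_mean f)
  = mean [set s | Defs.proper e s] f.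
Proof. by move=> v; elim: T => //= T <-; rewrite mean_proper_block_mean. Qed.

(** Updates keep proper colorings proper, so values at improper colorings never enter. *)
Lemma eq_iter_block_mean T f g : (forall s, Defs.proper e s -> f s = g s) ->
  forall s, Defs.proper e s -> iter T block_mean f s = iter T block_mean g s.
Proof.
move=> fg; elim: T => //= T IH s s_pr; apply: eq_mean => B _.
apply: eq_mean => t; rewrite recolorings_compatible // inE => /andP [t_pr _].
exact: IH.
Qed.

End Blocks.
End ManyColors.
End HeatBath.

(** * From oscillation decay to total variation *)

Section Mixing.
Variables (V : finType) (e : rel V) (k : nat) (P : {set {set V}}).
Hypotheses (e_sym : symmetric e) (e_irr : irreflexive e).
Hypotheses (k_gt : (2 * max_degree e < k)%N) (P_part : partition P [set: V]).
Local Notation col := (coloring V k).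

Lemma block_step_expect (f : col -> R) s : Defs.proper e s ->
  \sum_t block_step e P s t * f t = block_mean e P f s.
Proof.
move=> s_pr; rewrite /block_step /block_mean /mean.
under eq_bigr do rewrite -mulrA; rewrite -mulr_sumr; congr (_ * _).
under eq_bigr do rewrite mulr_suml; rewrite exchange_big /=.
apply: eq_bigr => B _; rewrite /heat_bath /mean recolorings_compatible //.
rewrite mulr_sumr [RHS]big_mkcond /=; apply: eq_bigr => t _.
by rewrite /block_update; case: ifP; rewrite ?mul0r.
Qed.

Lemma block_dist_expect T (f : col -> R) s : Defs.proper e s ->
  \sum_t block_dist e P s T t * f t = iter T (block_mean e P) f s.
Proof.
move=> s_pr; elim: T f => [|T IH] f /=.
  rewrite (bigD1 s) //= eqxx mul1r big1 ?addr0 // => t /negPf ->.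
  by rewrite mul0r.
under eq_bigr do rewrite mulr_suml; rewrite exchange_big /=.
under eq_bigr do (under eq_bigr do rewrite -mulrA; rewrite -mulr_sumr).
(* [block_dist] adds its new step last, so that step acts on [f] first. *)
rewrite IH -[RHS]/(iter T.+1 (block_mean e P) f s) iterSr.
by apply: eq_iter_block_mean => // t t_pr; apply: block_step_expect.
Qed.

Lemma tv_dist_block_dist T s : V -> Defs.proper e s ->
  tv_dist (block_dist e P s T) (@unif_proper V e k)
    <= (1 - (#|P| * (max_degree e).+1)%:R^-1) ^+ T * (#|V| * (max_degree e).+1)%:R.
Proof.
move=> v s_pr; rewrite /tv_dist ler_pdivrMl ?ltr0n //.
set mu := block_dist e P s T; set nu := @unif_proper V e k.
(* The sign is the optimal test function; its values differ by at most 2, which cancels the factor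
   1/2 in [tv_dist]. *)
pose f t : R := Num.sg (mu t - nu t).
have -> : \sum_t `|mu t - nu t| = \sum_t mu t * f t - \sum_t nu t * f t.
  by rewrite -sumrB; apply: eq_bigr => t _; rewrite normrEsg mulrC mulrBl.
have -> : \sum_t nu t * f t = mean [set t | Defs.proper e t] f.
  rewrite /mean mulr_sumr [RHS]big_mkcond; apply: eq_bigr => t _.
  by rewrite inE /nu /unif_proper; case: ifP; rewrite ?mul0r.
(* By stationarity both expectations become values of the same iterate, at [s] and averaged over
   proper starts. *)
rewrite block_dist_expect // -(mean_proper_iter e_sym P_part T f v).
rewrite lerBlDr -lerBlDl mulrA; apply: mean_ge.
  by apply/set0Pn; exists s; rewrite inE.
move=> t _; rewrite lerBlDr -lerBlDl; apply: iter_block_mean_le => //.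
have f1 x : `|f x| <= 1 by rewrite /f normr_sg lern1 leq_b1.
move=> x y; apply: (le_trans (ler_norm _)); apply: (le_trans (ler_normB _ _)).
exact: (lerD (f1 x) (f1 y)).
Qed.

End Mixing.

Theorem theorem3p1 :
  exists C : R, 0 < C /\
  forall (g : nat) (V : finType) (e : rel V) (Delta k : nat) (P : {set {set V}}),
    (3 <= g)%N ->
    simple_graph e ->
    girth_at_least e g ->
    Delta = max_degree e ->
    (0 < Delta)%N ->
    (2 * Delta < k)%N ->
    partition P [set: V] ->
    (forall B, B \in P -> diam_le_half_girth_minus3 e B g) ->
    mixing_time_le e k P (C * Delta%:R * #|V|%:R * Rpower.ln #|V|%:R).
Proof.
exists 9%:R; split; first by rewrite ltr0n.
move=> g V e D k P _ [e_sym e_irr] _ DE D0 k_gt P_part _; subst D.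
have [v deg_v] : exists v, degree e v = max_degree e.
  have V0 : (0 < #|V|)%N.
    rewrite lt0n; apply: contraTneq D0 => V0.
    by rewrite /max_degree big_pred0 // => v; have := card0_eq V0 v; rewrite inE.
  by have [v vE] := bigop.eq_bigmax (degree e) V0; exists v; rewrite -vE.
(* The neighbours of [v] do not include [v] itself. *)
have DV : (max_degree e < #|V|)%N.
  rewrite -deg_v /degree -cardsT; apply: proper_card.
  by apply/properP; split; [exact: subsetT|exists v; rewrite ?inE ?e_irr].
(* Blocks are nonempty and disjoint, so there are at most as many as vertices. *)
have PV : (0 < #|P| <= #|V|)%N.
  have /and3P [/eqP coverP _ P0] := P_part; apply/andP; split.
    apply/card_gt0P; exists (pblock P v).
    by rewrite pblock_mem // coverP inE.
  rewrite -cardsT (card_partition P_part) -sum1_card; apply: leq_sum => B BP.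
  by rewrite card_gt0; apply: contraNneq P0 => <-.
have /andP [/ssrnat.leP P1 /ssrnat.leP PV'] := PV.
have [T [T_tv T_le]] :=
  exists_number_of_steps _ _ _ (conj P1 PV') (elimT ssrnat.leP D0) (elimT ssrnat.leP DV).
exists T; split=> [s s_pr|].
  apply: (le_trans (tv_dist_block_dist e_sym e_irr k_gt P_part T v s_pr)).
  by move/RleP: T_tv; rewrite RmultE RpowE RminusE !RinvE (IZRposE 4) !INRE.
by move/RleP: T_le; rewrite !RmultE (IZRposE 9) !INRE.
Qed.
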